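(* Let $\mathcal{D}$ be a dataset of $N$ points whose $m$-dimensional metadata vectors are independently and uniformly distributed in $[0,S]^m$. Then the space complexity of the CubeGraph index of $\mathcal{D}$ is $O(N\cdot m)$, where the hierarchy depth $L$, the intra-cube maximum degree $M$, and the cross-cube maximum degree $M_{\mathrm{cross}}$ are treated as constants of the index configuration (i.e. the implied constant depends only on $L$, $M$, $M_{\mathrm{cross}}$).
   Context: Data points are $(\mathbf{x}_i,\mathbf{s}_i)$, $i=1,\dots,N$, with vector $\mathbf{x}_i\in\mathbb{R}^d$ and metadata $\mathbf{s}_i\in\mathbb{R}^m$. CubeGraph index: there are $L$ levels. At each level the metadata space is partitioned into a uniform grid of disjoint axis-aligned cubes, and each data point is assigned to the unique cube containing its metadata. Only non-empty cubes are stored. Within each non-empty cube a proximity graph on the vectors of its points is stored, in which each point has at most $M$ outgoing (intra-cube) edges. Two cubes of the same level are adjacent if their grid positions differ by one unit in exactly one dimension (so they share an $(m-1)$-dimensional face); a cube has at most $2m$ adjacent cubes. For each point $p$ in a cube $c$ and each cube adjacent to $c$, at most $M_{\mathrm{cross}}$ cross-cube edges from $p$ to points of that adjacent cube are stored. Space complexity means the total number of edges (neighbor references) stored over all points and levels; the vector data itself is stored separately, once per data point, and is not counted. *)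

(* Defs.v *)
From HB Require Import structures.
From mathcomp Require Import all_boot all_order all_algebra.
From mathcomp Require Import all_classical all_reals all_analysis.

Set Implicit Arguments.
Unset Strict Implicit.
Unset Printing Implicit Defensive.
Import Order.TTheory GRing.Theory Num.Theory.
Import numFieldNormedType.Exports.
Local Open Scope classical_set_scope.
Local Open Scope ring_scope.

Definition mutually_independent (R : realType) (disp : measure_display)
    (Omega : measurableType disp) (P : probability Omega R)
    (disp' : measure_display) (T : measurableType disp') (N : nat)
    (X : 'I_N -> {RV P >-> T}) : Prop :=
  forall (J : {set 'I_N}) (B : 'I_N -> set T),
    (forall i, measurable (B i)) ->
    P [set w | forall i, i \in J -> B i (X i w)]
      = (\prod_(i in J) P (X i @^-1` B i))%E.

(* [m.-tuple R] carries the product of the Borel sigma-algebras of R.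
   The uniform law on [0, S]^m is the m-fold product of the uniform law on
   [0, S]; the product measure is given by its values on measurable
   rectangles, which determine it. *)
Definition uniform_on_cube (R : realType) (disp : measure_display)
    (Omega : measurableType disp) (P : probability Omega R) (m : nat)
    (S : R) (S_gt0 : 0 < S) (X : {RV P >-> m.-tuple R}) : Prop :=
  forall A : 'I_m -> set R, (forall j, measurable (A j)) ->
    distribution P X [set s | forall j, A j (tnth s j)]
      = (\prod_(j < m) uniform_prob S_gt0 (A j))%E.

Record dataset (R : realType) (d m N : nat) := Dataset {
  vec : 'I_N -> 'rV[R]_d;
  meta : 'I_N -> m.-tuple R }.

Record grid (R : realType) (m : nat) := Grid {
  origin : m.-tuple R;
  side : R;
  side_gt0 : 0 < side }.

(* Cubes are half-open, so that the cubes of a grid partition R^m; a cube is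
   designated by its integer grid position. *)
Definition cube (R : realType) (m : nat) (g : grid R m) (k : m.-tuple int) :
    set (m.-tuple R) :=
  [set s | forall j : 'I_m,
     tnth (origin g) j + (tnth k j)%:~R * side g <= tnth s j
       < tnth (origin g) j + (tnth k j + 1)%:~R * side g].

Definition cube_of (R : realType) (m : nat) (g : grid R m) (s : m.-tuple R) :
    m.-tuple int :=
  [tuple Num.floor ((tnth s j - tnth (origin g) j) / side g) | j < m].

Lemma cube_ofP (R : realType) (m : nat) (g : grid R m) (k : m.-tuple int)
    (s : m.-tuple R) : cube g k s <-> cube_of g s = k.
Proof.
have h (j : 'I_m) : (tnth (origin g) j + (tnth k j)%:~R * side g <= tnth s j
       < tnth (origin g) j + (tnth k j + 1)%:~R * side g) =
    (Num.floor ((tnth s j - tnth (origin g) j) / side g) == tnth k j).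
  rewrite floor_eq ler_pdivlMr ?side_gt0// ltr_pdivrMr ?side_gt0//.
  by rewrite lerBrDl ltrBlDl.
split=> [ks|E j]; last by rewrite h -E tnth_mktuple.
by apply: eq_from_tnth => j; rewrite tnth_mktuple; apply/eqP; rewrite -h.
Qed.

Definition adjacent (m : nat) (c c' : m.-tuple int) : bool :=
  [exists j : 'I_m, (`|tnth c j - tnth c' j| == 1) &&
     [forall i : 'I_m, (i != j) ==> (tnth c i == tnth c' i)]].

Section Index.
Context (R : realType) (d m N : nat).
Implicit Type D : dataset R d m N.

Definition home (g : grid R m) D (i : 'I_N) : m.-tuple int :=
  cube_of g (meta D i).

Definition stored_cubes (g : grid R m) D : seq (m.-tuple int) :=
  undup (codom (home g D)).

(* Edges are ordered pairs (p, q): q is a reference stored at p.  The proximity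
   graph of a cube may be any directed graph on its points obeying the degree
   bound.  The values of [intra] and [cross] at cubes that are not stored, and
   of [cross] at non-adjacent cubes, are irrelevant. *)
Record cubegraph (L M Mcross : nat) D := CubeGraph {
  level : 'I_L -> grid R m;
  intra : 'I_L -> m.-tuple int -> {set 'I_N * 'I_N};
  cross : 'I_L -> m.-tuple int -> m.-tuple int -> {set 'I_N * 'I_N};
  intra_cube : forall l c p q, c \in stored_cubes (level l) D ->
    (p, q) \in intra l c ->
    home (level l) D p = c /\ home (level l) D q = c;
  intra_degree : forall l c p, c \in stored_cubes (level l) D ->
    (#|[set q | (p, q) \in intra l c]| <= M)%N;
  cross_cube : forall l c c' p q, c \in stored_cubes (level l) D ->
    c' \in stored_cubes (level l) D -> adjacent c c' ->
    (p, q) \in cross l c c' ->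
    home (level l) D p = c /\ home (level l) D q = c';
  cross_degree : forall l c c' p, c \in stored_cubes (level l) D ->
    c' \in stored_cubes (level l) D -> adjacent c c' ->
    (#|[set q | (p, q) \in cross l c c']| <= Mcross)%N }.

Definition space_complexity (L M Mcross : nat) D (G : cubegraph L M Mcross D) : nat :=
  (\sum_(l < L)
    (\sum_(c <- stored_cubes (level G l) D) #|intra G l c| +
     \sum_(c <- stored_cubes (level G l) D)
       \sum_(c' <- stored_cubes (level G l) D | adjacent c c')
         #|cross G l c c'|))%N.

End Index.

(* Main.v *)
(* Every edge is charged to its source point.  At a fixed level each point lies
   in exactly one stored cube and that cube has at most 2m adjacent cubes, so a
   point is charged at most M + 2m * Mcross times per level. *)
Require Import Defs.
From HB Require Import structures.
From mathcomp Require Import all_boot all_order all_algebra.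
From mathcomp Require Import all_classical all_reals all_analysis.
Import Order.TTheory GRing.Theory Num.Theory.
Import numFieldNormedType.Exports.
Local Open Scope ring_scope.

(** The [2 * m] face directions are indexed by an axis and a sign, [true] standing for a step of
    -1. *)
Definition neighbor {m : nat} (c : m.-tuple int) (jb : 'I_m * bool) :
    m.-tuple int :=
  [tuple tnth c i + (if i == jb.1 then (-1) ^+ jb.2 else 0) | i < m].

Lemma adjacent_neighbor {m : nat} {c c' : m.-tuple int} :
  Defs.adjacent c c' -> exists jb, c' = neighbor c jb.
Proof.
case/existsP=> j /andP[/eqP cj1 /forallP same].
have [b cj] : exists b : bool, tnth c' j = tnth c j + (-1) ^+ b.
  (* The difference is [c] minus [c'], so a nonnegative one places [c'] one step below [c]. *)
  have [cj|cj] := ger0P (tnth c j - tnth c' j);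
    rewrite ?(ger0_norm cj) ?(ltr0_norm cj) in cj1.
    by exists true; rewrite expr1 -cj1 opprB addrC subrK.
  by exists false; rewrite expr0 -cj1 opprB addrC subrK.
exists (j, b); apply: eq_from_tnth => i; rewrite tnth_mktuple /=.
case: eqP => [->|/eqP ij]; first exact: cj.
by rewrite addr0; apply/esym/eqP/(implyP (same i)).
Qed.

(** The adjacent members of [r] form a duplicate-free list contained in the codomain of
    [neighbor c], which lists [2 * m] values. *)
Lemma count_adjacent {m : nat} (c : m.-tuple int) {r : seq (m.-tuple int)} :
  uniq r -> (count (Defs.adjacent c) r <= 2 * m)%N.
Proof.
move=> r_uniq; have -> : (2 * m = size (codom (neighbor c)))%N.
  by rewrite size_codom card_prod card_ord card_bool mulnC.
rewrite -size_filter; apply: uniq_leq_size; first exact: filter_uniq.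
move=> c'; rewrite mem_filter => /andP[/adjacent_neighbor[jb ->] _].
exact: codom_f.
Qed.

(* In [cubegraph] the degree bounds count classical sets, not finsets. *)
Lemma card_mkset {T : finType} (A : pred T) : #|[set x | A x]%classic| = #|A|.
Proof.
by apply: eq_card => x; apply/idP/idP => [/set_mem//|Ax]; apply/mem_set.
Qed.

(** Grouping the edges by source leaves at most [K] for each point of [A]. This serves both
    intra-cube and cross-cube edges. *)
Lemma card_edges_le {T : finType} {K : nat} {A : {set T}} {E : {set T * T}} :
  (forall p q, (p, q) \in E -> p \in A) ->
  (forall p, (#|[pred q | (p, q) \in E]| <= K)%N) ->
  (#|E| <= #|A| * K)%N.
Proof.
move=> srcA degK.
have -> : #|E| = (\sum_(p in A) #|[pred q | (p, q) \in E]|)%N.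
  under eq_bigr do rewrite -sum1_card.
  rewrite pair_big_dep -sum1_card; apply: eq_bigl => -[p q] /=.
  rewrite inE; apply/idP/andP => [pqE|[]//].
  by split=> //; apply: srcA pqE.
by rewrite -sum_nat_const; apply: leq_sum => p _; apply: degK.
Qed.

Lemma level_edges_le {R : realType} {d m N L M Mcross : nat}
    {D : dataset R d m N} (G : cubegraph L M Mcross D) (l : 'I_L) :
  (\sum_(c <- stored_cubes (level G l) D) #|intra G l c| +
     \sum_(c <- stored_cubes (level G l) D)
       \sum_(c' <- stored_cubes (level G l) D | Defs.adjacent c c')
         #|cross G l c c'| <= N * (M + 2 * m * Mcross))%N.
Proof.
set r := stored_cubes _ _.
pose pts c := [set p | home (level G l) D p == c].
(* Double counting: after exchanging the sums, each point contributes 1, since its home cube occurs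
   exactly once in the duplicate-free list [r]. *)
have sum_pts : (\sum_(c <- r) #|pts c| = N)%N.
  under eq_bigr do rewrite -sum1dep_card big_mkcond /=.
  rewrite exchange_big /= -[RHS]card_ord -sum1_card; apply: eq_bigr => p _.
  rewrite -big_mkcond sum1_count.
  rewrite (eq_count (a2 := pred1 (home (level G l) D p))); last first.
    by move=> c; rewrite /= eq_sym.
  by rewrite count_uniq_mem ?undup_uniq// mem_undup codom_f.
(* Writing [N] as the sum of the [#|pts c|] reduces the bound to one inequality per stored cube. *)
rewrite -big_split -[leqRHS](congr1 (muln^~ _) sum_pts) big_distrl /=.
rewrite big_seq [leqRHS]big_seq.
apply: leq_sum => c cr; rewrite mulnDr; apply: leq_add.
  apply: card_edges_le => [p q pq|p]; last first.
    by rewrite -card_mkset; apply: intra_degree.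
  by rewrite inE; apply/eqP; case: (intra_cube cr pq).
rewrite mulnCA.
(* Each adjacent cube costs at most [Mcross] edges per point of [c]; it then remains to count the
   adjacent cubes. *)
apply: (@leq_trans (\sum_(c' <- r | Defs.adjacent c c') #|pts c| * Mcross)%N).
  rewrite big_seq_cond [leqRHS]big_seq_cond.
  apply: leq_sum => c' /andP[c'r cc'].
  apply: card_edges_le => [p q pq|p]; last first.
    by rewrite -card_mkset; apply: cross_degree.
  by rewrite inE; apply/eqP; case: (cross_cube cr c'r cc' pq).
by rewrite big_const_seq iter_addn_0 mulnC leq_mul2r count_adjacent ?orbT
  ?undup_uniq.
Qed.

Theorem theorem1 (L M Mcross : nat) :
  exists C : nat,
  forall (R : realType) (d m N : nat) (S : R) (S_gt0 : 0 < S)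
    (disp : measure_display) (Omega : measurableType disp)
    (P : probability Omega R)
    (x : Omega -> 'I_N -> 'rV[R]_d) (s : 'I_N -> {RV P >-> m.-tuple R}),
    (0 < m)%N ->
    mutually_independent s ->
    (forall i : 'I_N, uniform_on_cube S_gt0 (s i)) ->
  forall (w : Omega)
    (G : cubegraph L M Mcross (Dataset (x w) (fun i : 'I_N => s i w))),
    (space_complexity G <= C * (N * m))%N.
Proof.
(* Since [0 < m], the cost [M + 2 * m * Mcross] per point and level is at most
   [(M + 2 * Mcross) * m]. *)
exists (L * (M + 2 * Mcross))%N.
move=> R d m N S S_gt0 disp Omega P x s m_gt0 _ _ w G.
rewrite -mulnA -[leqRHS](congr1 (muln^~ _) (card_ord L)) -sum_nat_const.
apply: leq_sum => l _; apply: leq_trans (level_edges_le G l) _.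
rewrite mulnCA leq_mul2l mulnDl leq_add ?orbT//; last by rewrite mulnAC.
by rewrite leq_pmulr.
Qed.
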